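(* Let $K$ be a field with a non-trivial discrete valuation, with valuation ring $\mathcal O_K$, uniformizer $\pi$ and infinite residue field $\overline K$. Let $d,e$ be positive integers and let $\mathcal L=\langle A_1,\dots,A_d\rangle_K\subseteq\mathrm{Mat}_{d\times e}(K)$ be a linear space of matrices of dimension $d$. For $1\le i\le d$ write $A_i=(a_1^{(i)}\mid\dots\mid a_e^{(i)})$ by columns, and for $1\le j\le e$ put $B_j=(a_j^{(1)}\mid\dots\mid a_j^{(d)})\in\mathrm{Mat}_{d\times d}(K)$. Assume $B_j\in\mathrm{GL}(d,K)$ for all $j$, set $\Lambda_j=B_j^{-1}\mathcal O_K^d$ and $\Gamma=\{[\Lambda_1],\dots,[\Lambda_e]\}$. Let $\mathcal K=\mathcal L\cap\mathrm{Mat}_{d\times e}(\mathcal O_K)$ and let $\overline{\mathcal K}\subseteq\mathrm{Mat}_{d\times e}(\overline K)$ be the reduction of $\mathcal K$ modulo $\pi$. If $\mathcal K=\langle A_1,\dots,A_d\rangle_{\mathcal O_K}$ and $\dim(\mathcal{MP}(\overline{\mathcal K}))=d-1$, then $[\mathcal O_K^d]\in\mathrm{conv}(\Gamma)$.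
   Context: A lattice in $V=K^d$ is a (finitely generated) $\mathcal O_K$-submodule of $V$ of rank $d$; its homothety class is $[\Lambda]=\{c\Lambda: c\in K^\times\}$. A set $\Gamma$ of homothety classes of lattices is convex if for any $[\Lambda_1],[\Lambda_2]\in\Gamma$ and any $\tilde\Lambda_1\in[\Lambda_1]$, $\tilde\Lambda_2\in[\Lambda_2]$ one has $[\tilde\Lambda_1\cap\tilde\Lambda_2]\in\Gamma$. The convex hull $\mathrm{conv}(\Gamma)$ is the smallest convex set of homothety classes containing $\Gamma$; for finite $\Gamma=\{[\Lambda_1],\dots,[\Lambda_e]\}$ it equals $\{[\bigcap_{i=1}^e\pi^{m_i}\Lambda_i]: m_1,\dots,m_e\in\mathbb Z\}$. The multi-projective closure $\mathcal{MP}(\overline{\mathcal K})\subseteq(\mathbb P^{d-1}_{\overline K})^e$ is the Zariski closure of the set of points $(\alpha_1,\dots,\alpha_e)\in(\mathbb P^{d-1}_{\overline K})^e$ such that $(\alpha_1\mid\dots\mid\alpha_e)\in\overline{\mathcal K}$ and all columns $\alpha_i$ are nonzero (it may be empty). *)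

(* Defs.v *)
From HB Require Import structures.
From mathcomp Require Import all_boot all_order all_algebra.
From mathcomp Require Import ring_quotient mpoly.
From mathcomp Require Import classical_sets.

Set Implicit Arguments.
Unset Strict Implicit.
Unset Printing Implicit Defensive.

Import Order.TTheory GRing.Theory Num.Theory.
Local Open Scope quotient_scope.
Local Open Scope ring_scope.
Local Open Scope classical_set_scope.

(* The value [val_fun 0] is junk: every use of [v x] is guarded by [x != 0],
   which plays the role of the convention v(0) = +oo. *)
Record discrete_valuation (K : fieldType) := DiscreteValuation {
  val_fun :> K -> int;
  valM : forall x y, x != 0 -> y != 0 -> val_fun (x * y) = val_fun x + val_fun y;
  valD : forall x y, x != 0 -> y != 0 -> x + y != 0 ->
    Num.min (val_fun x) (val_fun y) <= val_fun (x + y);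
  val_nontrivial : exists2 x, x != 0 & val_fun x != 0
}.

Section ValuationRing.
Variables (K : fieldType) (v : discrete_valuation K).

Definition valring : {pred K} := [pred x | (x == 0) || (0 <= v x)].

Definition uniformizer (pi : K) : Prop :=
  [/\ pi != 0, 0 < v pi & forall x, x != 0 -> 0 < v x -> v pi <= v x].

Lemma val1 : v 1 = 0.
Proof.
have := valM v (oner_neq0 K) (oner_neq0 K); rewrite mulr1 => h.
by apply: (addrI (v 1)); rewrite -h addr0.
Qed.

Lemma valN x : v (- x) = v x.
Proof.
have [->|nz] := eqVneq x 0; first by rewrite oppr0.
have nz1 : -1 != 0 :> K by rewrite oppr_eq0 oner_neq0.
have h : v (-1) = 0.
  have := valM v nz1 nz1; rewrite mulrNN mulr1 val1 => /esym/eqP.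
  by rewrite -mulr2n mulrn_eq0 /= => /eqP.
by rewrite -mulN1r valM // h add0r.
Qed.

Lemma valV x : x != 0 -> v x^-1 = - v x.
Proof.
move=> nz; have nz' : x^-1 != 0 by rewrite invr_eq0.
by apply: (addrI (v x)); rewrite -valM // mulfV // val1 subrr.
Qed.

Fact valring_closed : subring_closed valring.
Proof.
split=> [|x y|x y]; rewrite !inE ?val1 ?lexx ?orbT //.
- have [->|nx] := eqVneq x 0; first by rewrite sub0r oppr_eq0 valN.
  have [->|ny] := eqVneq y 0; first by rewrite subr0 (negPf nx).
  have [//|nxy] := eqVneq (x - y) 0; move=> /= hx hy.
  have := valD v nx _ nxy; rewrite oppr_eq0 => /(_ ny); apply: le_trans.
  by rewrite le_min hx valN hy.
- have [->|nx] := eqVneq x 0; first by rewrite mul0r eqxx.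
  have [->|ny] := eqVneq y 0; first by rewrite mulr0 eqxx.
  by move=> /= hx hy; rewrite valM // addr_ge0 ?orbT.
Qed.

HB.instance Definition _ := GRing.isSubringClosed.Build K valring valring_closed.

Definition valring_type := {x : K | x \in valring}.
HB.instance Definition _ := SubChoice.on valring_type.
HB.instance Definition _ := [SubChoice_isSubComNzRing of valring_type by <:].

Definition maximal_ideal : {pred valring_type} :=
  [pred x : valring_type | (val x == 0) || (0 < v (val x))].

Fact maximal_ideal_closed : idealr_closed maximal_ideal.
Proof.
split; first by rewrite inE eqxx.
  by rewrite inE /= oner_eq0 val1 ltxx.
move=> a x y; rewrite !inE /=.
case: a x y => [a ha] [x hx] [y hy] /=; rewrite inE in ha.
have : (a * x == 0) || (0 < v (a * x)) \/ ~~ ((x == 0) || (0 < v x)).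
  have [->|nx] := eqVneq x 0; first by rewrite mulr0 eqxx; left.
  have [->|na] := eqVneq a 0; first by rewrite mul0r eqxx; left.
  rewrite (negPf na) /= in ha; rewrite /= valM //.
  have [px|] := boolP (0 < v x); last by right.
  by left; rewrite ltr_wpDl ?orbT.
case=> [|/negPf->] //; move: (a * x) => {hx ha a}x' hx' _.
have [->|nx] := eqVneq x' 0; first by rewrite add0r.
have [->|ny] := eqVneq y 0; first by rewrite addr0 hx'.
rewrite (negPf nx) /= in hx'; have [//|nxy] := eqVneq (x' + y) 0.
by move=> /= h; apply: lt_le_trans (valD v nx ny nxy); rewrite lt_min hx'.
Qed.

HB.instance Definition _ :=
  isIdealr.Build valring_type maximal_ideal maximal_ideal_closed.

Definition residue_field := {ideal_quot maximal_ideal}.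
HB.instance Definition _ := GRing.ComNzRing.on residue_field.

(* Meaningful for [x \in valring]; elements of [K] outside are sent to 0. *)
Definition residue (x : K) : residue_field :=
  \pi_(residue_field) (insubd (0 : valring_type) x).

Definition residue_inv (a : residue_field) : residue_field :=
  residue (val (repr a))^-1.

Fact residue_mulVf (a : residue_field) : a != 0 -> residue_inv a * a = 1.
Proof.
move=> nza; pose x := repr a.
have xE : \pi_(residue_field) x = a by rewrite reprK.
have xM : x \notin maximal_ideal.
  apply: contraNN nza => xm; rewrite -xE -(rmorph0 (\pi_(residue_field))).
  by rewrite -Quotient.idealrBE subr0.
move: xM; rewrite inE negb_or => /andP[nx].
rewrite -leNgt => vx_le0.
have xV : (val x)^-1 \in valring.
  by rewrite inE invr_eq0 (negPf nx) /= valV // oppr_ge0.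
rewrite /residue_inv /residue -{2}xE -rmorphM -(rmorph1 (\pi_(residue_field))).
congr (\pi _); apply: val_inj; rewrite rmorphM /= insubdK //.
by rewrite mulVf.
Qed.

Fact residue_inv0 : residue_inv 0 = 0.
Proof.
rewrite /residue_inv; set x := repr _.
have : x \in maximal_ideal.
  rewrite -[x]subr0 Quotient.idealrBE.
  by rewrite reprK rmorph0.
rewrite inE => h; rewrite /residue -(rmorph0 (\pi_(residue_field))).
congr (\pi _); apply: val_inj; rewrite val_insubd inE invr_eq0.
have [->|nx] := eqVneq (val x) 0; first by rewrite invr0.
rewrite (negPf nx) /= in h; rewrite /= valV // oppr_ge0 leNgt h.
by [].
Qed.

HB.instance Definition _ :=
  GRing.ComNzRing_isField.Build residue_field residue_mulVf residue_inv0.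

End ValuationRing.

Section Lattices.
Variables (K : fieldType) (v : discrete_valuation K) (d : nat).
Local Notation V := 'cV[K]_d.

(* The O_K-submodule generated by the columns of [G] spans a K-subspace of
   dimension [\rank G], so its rank is [\rank G]. *)
Definition lattice (L : set V) : Prop :=
  exists n (G : 'M[K]_(d, n)), \rank G = d /\
    L = [set G *m c | c in [set c | c \is a mxOver (valring v)]].

Definition std_lattice : set V := [set x | x \is a mxOver (valring v)].

Definition homothety_class (L : set V) : set (set V) :=
  [set [set c *: x | x in L] | c in [set c : K | c != 0]].

Definition convex (G : set (set (set V))) : Prop :=
  G `<=` [set homothety_class L | L in lattice] /\
  forall C1 C2, G C1 -> G C2 -> forall L1 L2, C1 L1 -> C2 L2 ->
    G (homothety_class (L1 `&` L2)).

Definition conv (G : set (set (set V))) : set (set (set V)) :=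
  smallest convex G.

End Lattices.
Arguments std_lattice {K} v d _.

Section KrullDimension.
Variables (X : Type) (closed : set X -> Prop).

Definition irreducible_closed (Z : set X) : Prop :=
  [/\ closed Z, Z !=set0 & forall Z1 Z2, closed Z1 -> closed Z2 ->
    Z `<=` Z1 `|` Z2 -> Z `<=` Z1 \/ Z `<=` Z2].

(* Only used for closed [Y], whose closed subsets are the closed subsets of
   [X] contained in [Y]. *)
Definition irreducible_chain (Y : set X) (n : nat) : Prop :=
  exists Z : nat -> set X,
    (forall i, (i <= n)%N -> irreducible_closed (Z i) /\ Z i `<=` Y) /\
    (forall i, (i < n)%N -> Z i `<` Z i.+1).

Definition has_krull_dim (Y : set X) (n : nat) : Prop :=
  irreducible_chain Y n /\ forall m, irreducible_chain Y m -> (m <= n)%N.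

End KrullDimension.

(* The e-fold product of P^{d-1} over [k] as a scheme: the coordinate [i] of
   the factor [j] is the variable ['X_(mxvec_index i j)], and the points are
   the multihomogeneous prime ideals containing no irrelevant ideal
   (x_{ij} : i < d).  Classically, boolean-valued ideals are all ideals. *)
Section MultiProjectiveSpace.
Variables (k : fieldType) (d e : nat).
Local Notation S := {mpoly k[d * e]}.

Definition multideg (m : 'X_{1..d * e}) : 'X_{1..e} :=
  [multinom (\sum_(i < d) m (mxvec_index i j))%N | j < e].

Definition multihomog_component (D : 'X_{1..e}) (p : S) : S :=
  \sum_(m <- msupp p | multideg m == D) p@_m *: 'X_[m].

Definition multihomogeneous (p : S) : Prop :=
  exists D, p = multihomog_component D p.

Record mp_point := MPPoint {
  mp_ideal :> prime_idealr S;
  mp_ideal_multihomog : forall D p,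
    p \in mp_ideal -> multihomog_component D p \in mp_ideal;
  mp_ideal_relevant : forall j : 'I_e,
    exists i : 'I_d, 'X_(mxvec_index i j) \notin mp_ideal
}.

Definition mp_closed (Z : set mp_point) : Prop :=
  exists F : set S, F `<=` multihomogeneous /\
    Z = [set x : mp_point | forall p, F p -> p \in (x : prime_idealr S)].

Section RationalPoint.
Variable alpha : 'M[k]_(d, e).
Hypothesis alpha_nz : forall j, col j alpha != 0.

(* p(alpha_1 t_1 | ... | alpha_e t_e) in k[t_1, ..., t_e]: the coefficient of
   t^D is the value at [alpha] of the component of [p] of multidegree D. *)
Definition column_scaling : S -> {mpoly k[e]} :=
  mmap (@mpolyC e k)
    (fun l => mxvec (\matrix_(i < d, j < e) (alpha i j *: 'X_j)) 0 l).

Definition rational_ideal : {pred S} := [pred p | column_scaling p == 0].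

HB.instance Definition _ := GRing.RMorphism.on column_scaling.

Fact rational_ideal_closed : idealr_closed rational_ideal.
Proof.
split; rewrite ?inE ?rmorph0 ?rmorph1 ?oner_eq0 ?eqxx // => a x y.
by rewrite !inE rmorphD rmorphM /= => /eqP-> /eqP->; rewrite mulr0 addr0.
Qed.

HB.instance Definition _ := isIdealr.Build S rational_ideal rational_ideal_closed.

Fact rational_ideal_prime : prime_idealr_closed rational_ideal.
Proof. by move=> p q; rewrite !inE rmorphM /= mulf_eq0. Qed.

HB.instance Definition _ :=
  isPrimeIdealrClosed.Build S rational_ideal rational_ideal_prime.

Lemma column_scalingXm m : exists c, column_scaling 'X_[m] = c *: 'X_[multideg m].
Proof.
have prodE (R : comNzRingType) (F : 'I_(d * e) -> R) :
    \prod_l F l = \prod_j \prod_i F (mxvec_index i j).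
  rewrite (reindex _ (curry_mxvec_bij _ _)) exchange_big /= pair_bigA.
  by apply: eq_bigr => -[].
exists (\prod_j \prod_i alpha i j ^+ m (mxvec_index i j)).
rewrite /column_scaling mmapX /mmap1 prodE mpolyXE_id -scaler_prod.
apply: eq_bigr => j _; rewrite mnmE -prodrXr -scaler_prod.
by apply: eq_bigr => i _; rewrite mxvecE mxE exprZn.
Qed.

Fact rational_ideal_multihomog D p :
  p \in rational_ideal -> multihomog_component D p \in rational_ideal.
Proof.
rewrite !inE => /eqP p0; apply/eqP.
have -> : column_scaling (multihomog_component D p)
    = (column_scaling p)@_D *: 'X_[D].
  have lin c q : column_scaling (c *: q) = c *: column_scaling q.
    by rewrite /column_scaling mmapZ mul_mpolyC.
  have -> : column_scaling p
      = \sum_(m <- msupp p) p@_m *: column_scaling 'X_[m].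
    by rewrite {1}[p]mpolyE raddf_sum; apply: eq_bigr => m _; apply: lin.
  rewrite /multihomog_component !raddf_sum /= scaler_suml big_mkcond.
  apply: eq_bigr => m _; have [c cE] := column_scalingXm m.
  rewrite cE !mcoeffZ mcoeffX.
  have [<-|_] := eqVneq (multideg m) D; last by rewrite !mulr0 scale0r.
  by rewrite lin cE scalerA !mulr1.
by rewrite p0 mcoeff0 scale0r.
Qed.

Fact rational_ideal_relevant (j : 'I_e) :
  exists i : 'I_d, 'X_(mxvec_index i j) \notin rational_ideal.
Proof.
have /cV0Pn[i] := alpha_nz j; rewrite mxE => nz; exists i; rewrite inE.
rewrite /column_scaling mmapX mmap1U mxvecE mxE.
by rewrite scaler_eq0 negb_or nz -msupp_eq0 msuppX.
Qed.

Definition rational_point : mp_point :=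
  MPPoint rational_ideal_multihomog rational_ideal_relevant.

End RationalPoint.

Definition mp_closure (M : set 'M[k]_(d, e)) : set mp_point :=
  smallest mp_closed
    [set x | exists alpha (nz : forall j, col j alpha != 0),
               M alpha /\ x = rational_point nz].

End MultiProjectiveSpace.

Section MatrixSpaces.
Variables (K : fieldType) (v : discrete_valuation K) (d e : nat).

Definition integral_part (L : {vspace 'M[K]_(d, e)}) : set 'M[K]_(d, e) :=
  [set M | M \in L /\ M \is a mxOver (valring v)].

Definition valring_span (A : 'I_d -> 'M[K]_(d, e)) : set 'M[K]_(d, e) :=
  [set \sum_i c i *: A i | c in [set c : 'I_d -> K | forall i, c i \in valring v]].

Definition reduction (M : set 'M[K]_(d, e)) : set 'M[residue_field v]_(d, e) :=
  map_mx (residue v) @` M.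

Definition col_matrix (A : 'I_d -> 'M[K]_(d, e)) (j : 'I_e) : 'M[K]_d :=
  \matrix_(r < d, i < d) A i r j.

Definition col_lattice (A : 'I_d -> 'M[K]_(d, e)) (j : 'I_e) : set 'cV[K]_d :=
  [set invmx (col_matrix A j) *m x | x in std_lattice v d].

End MatrixSpaces.

(* Main.v *)
Require Import Defs.
From mathcomp Require Import all_boot all_order all_algebra.
From mathcomp Require Import ring_quotient mpoly.
From mathcomp Require Import classical_sets cardinality.

(** Write [B_j] for [col_matrix A j].  A combination [\sum_i x_i A_i] has
    columns [B_j x], and [Lambda_j = B_j^-1 O_K^d] consists of the [x] for which
    [B_j x] is integral; so the combination is integral exactly when [x] lies in
    every [Lambda_j].  The hypothesis that the [A_i] generate the integral
    matrices of [L] over the valuation ring therefore says that the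
    intersection of the [Lambda_j] is [O_K^d] itself
    ([bigcap_col_lattice]).  A convex set of homothety classes is stable under
    intersections of finite nonempty families of representatives
    ([convex_bigcap]), so every convex set containing the classes of the
    [Lambda_j] contains the class of [O_K^d]. *)

Set Implicit Arguments.
Unset Strict Implicit.
Unset Printing Implicit Defensive.

Import Order.TTheory GRing.Theory Num.Theory.
Local Open Scope ring_scope.
Local Open Scope classical_set_scope.

Section Convexity.
Variables (K : fieldType) (v : discrete_valuation K) (d : nat).

Lemma homothety_class_refl (L : set 'cV[K]_d) : homothety_class L L.
Proof.
exists 1; first exact: oner_neq0.
apply/seteqP; split=> [x [y Ly <-]|x Lx]; first by rewrite scale1r.
by exists x; rewrite ?scale1r.
Qed.

(** The index [i0] guarantees a nonempty family: the empty intersection is all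
    of [K^d], which is not a lattice when [d > 0]. *)
Lemma convex_bigcap (I : finType) (i0 : I) (F : I -> set 'cV[K]_d) G :
  convex v G -> (forall i, G (homothety_class (F i))) ->
  G (homothety_class (\bigcap_i F i)).
Proof.
move=> [_ Gcap] GF.
have capE : \bigcap_i F i = \big[setI/setT]_(i <- i0 :: enum I) F i.
  rewrite -bigcap_seq; apply: eq_bigcapl; split=> // i _ /=.
  by rewrite inE mem_enum orbT.
rewrite {}capE; elim: (enum I) i0 => [|i s IHs] j; first by rewrite big_seq1.
rewrite big_cons.
exact: Gcap (GF j) (IHs i) _ _ (homothety_class_refl _) (homothety_class_refl _).
Qed.

End Convexity.

Section ColumnLattices.
Variables (K : fieldType) (v : discrete_valuation K) (d e : nat).
Variable A : 'I_d -> 'M[K]_(d, e).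

Lemma col_lincomb (x : 'cV[K]_d) j :
  col j (\sum_i x i 0 *: A i) = col_matrix A j *m x.
Proof.
apply/colP => r; rewrite !mxE summxE; apply: eq_bigr => i _.
by rewrite !mxE mulrC.
Qed.

Lemma col_latticeE j : col_matrix A j \in unitmx ->
  col_lattice v A j = [set x | col_matrix A j *m x \is a mxOver (valring v)].
Proof.
move=> Bu; apply/seteqP; split=> [x [y Oy <-]|x Bx] /=.
  by rewrite mulKVmx.
by exists (col_matrix A j *m x); rewrite ?mulKmx.
Qed.

Lemma integral_lincombP (x : 'cV[K]_d) :
  \sum_i x i 0 *: A i \is a mxOver (valring v) <->
  forall j, col_matrix A j *m x \is a mxOver (valring v).
Proof.
split=> [/mxOverP Ox j|Ox].
  by rewrite -col_lincomb; apply/mxOverP => r k; rewrite mxE.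
apply/mxOverP => r j; have /mxOverP/(_ r 0) := Ox j.
by rewrite -col_lincomb mxE.
Qed.

(** Since [B_j] is invertible for some [j], the coefficients of a combination of
    the [A_i] are determined by the combination; this turns an equality of
    spans into an equality of sets of coefficients. *)
Lemma bigcap_col_lattice (L : {vspace 'M[K]_(d, e)}) (j0 : 'I_e) :
  L = <<codom A>>%VS -> (forall j, col_matrix A j \in unitmx) ->
  integral_part v L = valring_span v A ->
  \bigcap_j col_lattice v A j = std_lattice v d.
Proof.
move=> defL Bu defO; apply/seteqP; split=> [x Bx|x /mxOverP Ox].
  have : integral_part v L (\sum_i x i 0 *: A i).
    split; last first.
      by apply/integral_lincombP => j; have := Bx j I; rewrite col_latticeE.
    by rewrite defL memv_suml // => i _; rewrite memvZ // memv_span // codom_f.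
  rewrite defO => -[c Oc cE]; pose y : 'cV[K]_d := \col_i c i.
  have <- : y = x.
    rewrite -[LHS](mulKmx (Bu j0)) -[RHS](mulKmx (Bu j0)) -!col_lincomb -cE.
    by congr (_ *m col _ _); apply: eq_bigr => i _; rewrite mxE.
  by apply/mxOverP => i k; rewrite mxE.
have : valring_span v A (\sum_i x i 0 *: A i).
  by exists (fun i => x i 0) => // i; apply: Ox.
rewrite -defO => -[_ /integral_lincombP Bx] j _.
by rewrite col_latticeE //; apply: Bx.
Qed.

End ColumnLattices.

Theorem theorem3p16 (K : fieldType) (v : discrete_valuation K) (pi : K)
    (hpi : uniformizer v pi)
    (hres : infinite_set [set: residue_field v])
    (d e : nat) (hd : (0 < d)%N) (he : (0 < e)%N)
    (A : 'I_d -> 'M[K]_(d, e)) (L : {vspace 'M[K]_(d, e)})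
    (hL : L = <<codom A>>%VS) (hdim : \dim L = d)
    (hB : forall j : 'I_e, col_matrix A j \in unitmx)
    (hA : integral_part v L = valring_span v A)
    (hMP : has_krull_dim (@mp_closed (residue_field v) d e)
             (mp_closure (reduction (integral_part v L))) d.-1) :
  conv v (range (fun j : 'I_e => homothety_class (col_lattice v A j)))
    (homothety_class (std_lattice v d)).
Proof.
move=> G [Gconv GA].
rewrite -(bigcap_col_lattice (Ordinal he) hL hB hA).
by apply: (convex_bigcap (Ordinal he) Gconv) => j; apply: GA; exists j.
Qed.
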